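(* For every $k\in\mathbb{N}$, every graph $G$ and every set $\mathcal{A}\subseteq V(G)$, either $G$ contains $k$ pairwise anti-complete $\mathcal{A}$-paths, or there exists a set $Z\subseteq V(G)$ with $|Z|\leq 54(k-1)$ such that $G-N_G[Z]$ has no $\mathcal{A}$-paths.
   Context: $\mathbb{N}=\{1,2,\dots\}$. Graphs are finite, simple and undirected. For a graph $G$ and $\mathcal{A}\subseteq V(G)$, an $\mathcal{A}$-path in $G$ is a path in $G$ (not necessarily induced) with at least one edge whose two endpoints belong to $\mathcal{A}$ (internal vertices may also belong to $\mathcal{A}$). Two sets $X,Y\subseteq V(G)$ are anti-complete if $X\cap Y=\emptyset$ and there is no edge of $G$ with one end in $X$ and the other in $Y$; two paths in $G$ are anti-complete if their vertex sets are. For $Z\subseteq V(G)$, $N_G[Z]$ is the closed neighbourhood of $Z$, i.e. the set of vertices of $G$ at distance at most $1$ in $G$ from some vertex of $Z$. For $S\subseteq V(G)$, $G-S$ is the subgraph of $G$ induced by $V(G)\setminus S$; an $\mathcal{A}$-path of $G-S$ is an $\mathcal{A}$-path of $G$ all of whose vertices avoid $S$. *)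

(* Defs.v *)
From mathcomp Require Import all_boot.
Set Implicit Arguments.
Unset Strict Implicit.
Unset Printing Implicit Defensive.

(* A finite simple graph is a symmetric irreflexive relation [e] on a finType. *)
Section Graph.
Variables (T : finType) (e : rel T).

(* Paths of the graph are duplicate-free sequences of consecutively adjacent
   vertices; [1 < size p] says that the path has at least one edge. *)
Definition graph_path (p : seq T) : bool := sorted e p && uniq p.

Definition A_path (A : {set T}) (p : seq T) : bool :=
  if p is x :: q
  then [&& graph_path p, 1 < size p, x \in A & last x q \in A]
  else false.

Definition anticomplete (X Y : {set T}) : Prop :=
  X :&: Y = set0 /\ forall x y, x \in X -> y \in Y -> ~~ e x y.

Definition anticomplete_paths (p q : seq T) : Prop :=
  anticomplete [set:: p] [set:: q].

Definition closed_nbhd (Z : {set T}) : {set T} :=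
  [set v | [exists z in Z, (v == z) || e z v]].

(* An A-path of the graph obtained by deleting the vertices of [S]. *)
Definition A_path_minus (S A : {set T}) (p : seq T) : bool :=
  A_path A p && all [predC S] p.

End Graph.

(* Main.v *)
Require Import Defs.
From mathcomp Require Import all_boot.
From mathcomp Require Import zify.
From Stdlib Require Import Classical.

(** Grow a forest of paths greedily, always taking the shortest available path,
and keep a set Z of marked vertices whose closed neighbourhood the next path has
to avoid. A _piece_ is either a _root_, an A-path with no neighbour in what has
been built, or a _leg_, a path from A whose last vertex is its only vertex with
a neighbour in what has been built. Legs have priority over roots. As long as
some A-path avoids N[Z], a leg or a root exists ([grow]).

The point of shortest-first growth is that a vertex w outside the forest and
outside N[Z] can see the forest only locally ([grown_local]): all its neighbours
there lie on a single piece, within distance 2 along it. Two remote neighbours on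
one piece would give a shorter piece through w; neighbours on two pieces would
give a shorter leg in place of the later of them, or, if the later one is a root,
a leg at a time when there was none. Hence the last vertex of a new leg sees one
older piece only, its _host_, near one chosen neighbour, the _anchor_ of the leg.
Each new piece marks boundedly many vertices: its ends, for a leg also its
penultimate vertex and the seven vertices around the anchor. This costs 2 for a
root and at most 10 for a leg, and keeps the anchors on one host at distance at
least 4 from each other.

The forest contains many anti-complete A-paths. The roots are pairwise
anti-complete. A host with m legs is a comb, and pairing up legs that are
consecutive along it gives at least m/2 anti-complete A-paths ([comb_packing]);
an unpaired leg is joined to the end of the host that lies in A. Two-colour the
pieces so that a leg and its host differ. The combs of hosts of one colour are
pairwise anti-complete, because a comb never uses the vertex by which its host
may be attached to another comb.
So if there are no k anti-complete A-paths, there are at most k-1 roots and, for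
each of the two colours, at most 2(k-1) legs. The growth then stops, with
|Z| <= 2(k-1) + 10 * 4(k-1) = 42(k-1). *)

Set Implicit Arguments.
Unset Strict Implicit.
Unset Printing Implicit Defensive.

Section CoarseGallai.
Variables (T : finType) (e : rel T) (A : {set T}).
Hypothesis e_sym : symmetric e.

(** * Connectivity inside a vertex set *)

Lemma mem_slice (p : seq T) m n v : uniq p ->
  (v \in take n (drop m p)) = (v \in p) && (m <= index v p < m + n).
Proof.
move=> Up; have [vp|vNp] /= := boolP (v \in p); last first.
  by apply: contraNF vNp => /mem_take/mem_drop.
have [le_mv|lt_vm] /= := leqP m (index v p); last first.
  apply/negP => /mem_take v_drop.
  have v_take : v \in take m p by rewrite in_take.
  by move: Up; rewrite -(cat_take_drop m p) cat_uniq => /and3P[_ /hasP[]]; exists v.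
have v_take : v \notin take m p by rewrite in_take // -leqNgt.
have v_drop : v \in drop m p.
  by move: vp; rewrite -{1}(cat_take_drop m p) mem_cat (negPf v_take).
rewrite in_take //.
have -> : index v p = m + index v (drop m p); last by rewrite ltn_add2l.
rewrite -{1}(cat_take_drop m p) index_cat (negPf v_take) size_take.
by move: le_mv (index_size v p); case: ltnP => // ? ? ?; congr (_ + _); lia.
Qed.

(** A-paths are obtained below from connectedness inside a vertex set rather
than by concatenating walks: no disjointness of the concatenated parts is then
needed, as a repetition-free path can be extracted at the end. *)
Definition inside (S : {set T}) : rel T := [rel x y | [&& x \in S, y \in S & e x y]].

Lemma inside_sym S : connect_sym (inside S).
Proof. by apply: sym_connect_sym => x y; rewrite /inside /= e_sym andbCA. Qed.

Lemma connect_walk (S : {set T}) p u v :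
  sorted e p -> {subset p <= S} -> u \in p -> v \in p -> connect (inside S) u v.
Proof.
case: p => //= x q.
have from_x y : path e x q -> {subset x :: q <= S} -> y \in x :: q ->
    connect (inside S) x y.
  elim: q x => [|z q IHq] x /= => [_ _|]; first by rewrite inE => /eqP->.
  case/andP=> exz ezq sub; rewrite inE => /orP[/eqP-> // | yzq].
  have zS : z \in S by apply: sub; rewrite !inE eqxx orbT.
  apply: connect_trans (IHq z ezq _ yzq) => [|w w_in]; last first.
    by apply: sub; rewrite inE w_in orbT.
  by apply: connect1; rewrite /inside /= zS exz sub ?mem_head.
move=> exq sub uq vq; apply: connect_trans (from_x v exq sub vq).
by rewrite inside_sym from_x.
Qed.

Lemma connect_A_path (S : {set T}) x y : connect (inside S) x y ->
  x \in A -> y \in A -> x != y -> exists2 p, A_path e A p & {subset p <= S}.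
Proof.
move=> /connectP[q0 pq0 ->{y}] xA; case: (shortenP pq0) => q pq Uq _ yA neq.
have q_gt0 : q != [::] by apply: contraNneq neq => ->.
exists (x :: q).
  rewrite /A_path /graph_path xA yA Uq !andbT ltnS lt0n size_eq0 q_gt0 andbT.
  by apply: sub_path pq => a b /and3P[].
have : {subset q <= S}.
  elim: q x pq {Uq xA yA neq q_gt0 pq0} => //= z q IHq x /andP[/and3P[_ zS _] pzq] w.
  by rewrite inE => /predU1P[->|]//; apply: IHq pzq w.
case: q pq q_gt0 {Uq yA neq} => //= z q /andP[/and3P[xS _ _] _] _ sub w.
by rewrite inE => /predU1P[->|/sub].
Qed.

(** * Shortest walks *)

(** Legs and roots are both instances of this notion: [Q] constrains the two
ends together, [f] every vertex. Repetitions are allowed, so that shortcuts of a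
walk need no care; shortest walks are repetition-free anyway. *)
Definition link (f : pred T) (Q : rel T) (p : seq T) :=
  if p is x :: q then [&& path e x q, Q x (last x q) & all f p] else false.

Definition shortest f Q p :=
  link f Q p /\ forall p', link f Q p' -> size p <= size p'.

Lemma ex_shortest f Q p : link f Q p -> exists p', shortest f Q p'.
Proof.
have [n] := ubnP (size p); elim: n p => // n IHn p lt_pn lp.
have [[p' [lp' lt_p']]|no_shorter] :=
    classic (exists p', link f Q p' /\ size p' < size p).
  by apply: IHn lp'; lia.
exists p; split=> // p' lp'; rewrite leqNgt; apply/negP => lt_p'.
by apply: no_shorter; exists p'.
Qed.

Lemma last_take (x : T) q k : k <= size q -> last x (take k q) = nth x (x :: q) k.
Proof.
move=> le_k; rewrite (last_nth x) size_takel //.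
by rewrite -/(take k.+1 (x :: q)) nth_take.
Qed.

Lemma last_take_index (x : T) q u : u \in x :: q ->
  last x (take (index u (x :: q)) q) = u.
Proof.
move=> uq; rewrite last_take ?nth_index //.
by move: uq; rewrite -index_mem.
Qed.

Lemma shortest_path f Q p : shortest f Q p -> sorted e p.
Proof. by case: p => [|x q] [] //= /and3P[]. Qed.

Lemma shortest_all f Q p : shortest f Q p -> all f p.
Proof. by case: p => [|x q] [] //= /and3P[]. Qed.

(** Replacing the part strictly between positions [i] and [j] (and the vertex at
[j], which ends [r]) by [r] yields a walk with the same ends, hence not a shorter
one. The case [r = [::]] excludes repetitions, a one-vertex [r] excludes chords
and a two-vertex [r] bounds detours through an outside vertex. *)
Lemma shortest_splice f Q x q i j r : shortest f Q (x :: q) ->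
  i <= size q -> j <= size q ->
  path e (nth x (x :: q) i) r -> last (nth x (x :: q) i) r = nth x (x :: q) j ->
  all f r -> j <= i + size r.
Proof.
case=> /and3P[exq Qx /= /andP[fx fq]] minq le_i le_j er last_r fr.
pose q' := take i q ++ r ++ drop j q.
have lq' : link f Q (x :: q').
  have [ei fi] : path e x (take i q) /\ all f (take i q).
    by move: exq fq; rewrite -{1 2}(cat_take_drop i q) cat_path all_cat; do 2!case/andP=> ? _.
  have [ej fj] : path e (nth x (x :: q) j) (drop j q) /\ all f (drop j q).
    rewrite -last_take //; move: exq fq; rewrite -{1 2}(cat_take_drop j q).
    by rewrite cat_path all_cat; do 2!case/andP=> _ ?.
  have lj : last (nth x (x :: q) j) (drop j q) = last x q.
    by rewrite -last_take // -{3}(cat_take_drop j q) last_cat.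
  by rewrite /= !cat_path !last_cat last_take // last_r lj ei er ej Qx fx !all_cat fi fr.
have := minq _ lq'; rewrite /= !size_cat size_takel // size_drop; lia.
Qed.

Definition gap (p : seq T) (u v : T) :=
  (index u p - index v p) + (index v p - index u p).

Lemma gapC p u v : gap p u v = gap p v u.
Proof. by rewrite /gap addnC. Qed.

Lemma shortest_route f Q p u v r : shortest f Q p -> u \in p -> v \in p ->
  path e u r -> last u r = v -> all f r -> index v p <= index u p + size r.
Proof.
case: p => [|x q] // sp uq vq er last_r fr.
have le_index w : w \in x :: q -> index w (x :: q) <= size q by rewrite -index_mem.
by apply: (shortest_splice sp) => //; rewrite ?le_index ?nth_index.
Qed.

Lemma shortest_uniq f Q p : shortest f Q p -> uniq p.
Proof.
case: p => [|x q] // sp.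
have le_pos i j : i <= size q -> j <= size q ->
    nth x (x :: q) i = nth x (x :: q) j -> j <= i.
  move=> le_i le_j eq_ij.
  by have := shortest_splice (r := [::]) sp le_i le_j; rewrite addn0; apply.
apply/(uniqP x) => i j; rewrite !unfold_in /= !ltnS => le_i le_j eq_ij.
apply/eqP; rewrite eqn_leq; apply/andP; split; exact: le_pos.
Qed.

Lemma shortest_chord f Q p u v : shortest f Q p -> u \in p -> v \in p ->
  e u v -> gap p u v <= 1.
Proof.
move=> sp up vp euv.
have fu := allP (shortest_all sp) _ up; have fv := allP (shortest_all sp) _ vp.
have := shortest_route (r := [:: v]) sp up vp.
have := shortest_route (r := [:: u]) sp vp up.
rewrite /= fu fv euv e_sym euv /gap => /(_ isT erefl isT) + /(_ isT erefl isT).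
lia.
Qed.

Lemma shortest_detour f Q p u v w : shortest f Q p -> u \in p -> v \in p ->
  f w -> e w u -> e w v -> gap p u v <= 2.
Proof.
move=> sp up vp fw ewu ewv.
have fu := allP (shortest_all sp) _ up; have fv := allP (shortest_all sp) _ vp.
have := shortest_route (r := [:: w; v]) sp up vp.
have := shortest_route (r := [:: w; u]) sp vp up.
rewrite /= fu fv fw !(e_sym _ w) ewu ewv /gap => /(_ isT erefl isT) + /(_ isT erefl isT).
lia.
Qed.

(** * Pieces and the region still available *)

(** A piece consists of its path, a colour, and, for a leg, its anchor. The path
starts in A, and that of a leg ends next to the anchor. The host of a leg is not
recorded: it is the piece that contains the anchor. *)
Local Notation piece := (seq T * bool * option T)%type.
Definition track (d : piece) := d.1.1.
Definition color (d : piece) := d.1.2.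
Definition anchor (d : piece) := d.2.

Definition covered (s : seq piece) v := has (fun d : piece => v \in track d) s.
Definition free s (Z : {set T}) v := (v \notin closed_nbhd e Z) && ~~ covered s v.
Definition touches s v := [exists u, covered s u && e v u].
Definition approach s : rel T := fun x y => (x \in A) && touches s y.
Definition crossing : rel T := fun x y => [&& x \in A, y \in A & x != y].
Definition child_of (j d : piece) := if anchor d is Some a then a \in track j else false.

Lemma coveredP s v : reflect (exists2 d : piece, d \in s & v \in track d) (covered s v).
Proof. exact: hasP. Qed.

Lemma touchesP s v : reflect (exists2 u, covered s u & e v u) (touches s v).
Proof.
by apply: (iffP existsP) => [[u /andP[]]|[u su evu]]; exists u; rewrite ?su.
Qed.

Lemma free_sub d s (Z Z' : {set T}) v : Z \subset Z' ->
  free (d :: s) Z' v -> [/\ free s Z v, v \notin closed_nbhd e Z' & v \notin track d].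
Proof.
move=> sub /andP[vZ' /=]; rewrite negb_or => /andP[vd vs]; split=> //.
rewrite /free vs andbT; apply: contra vZ'; rewrite !inE => /existsP[z /andP[zZ zv]].
by apply/existsP; exists z; rewrite (subsetP sub).
Qed.

Lemma closed_nbhd_self (Z : {set T}) v : v \in Z -> v \in closed_nbhd e Z.
Proof. by move=> vZ; rewrite inE; apply/existsP; exists v; rewrite vZ eqxx. Qed.

Lemma closed_nbhd_adj (Z : {set T}) v z : v \notin closed_nbhd e Z -> e v z -> z \notin Z.
Proof.
move=> vZ evz; apply: contra vZ => zZ.
by rewrite inE; apply/existsP; exists z; rewrite zZ e_sym evz orbT.
Qed.

(** Leaving a walk from A at one of its vertices [u], along [r], gives a leg as
soon as the end of [r] has a neighbour in the forest. Used with [r] empty or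
reduced to one vertex outside the walk. *)
Lemma approach_stop s Z x q u r : path e x q -> x \in A -> all (free s Z) (x :: q) ->
    u \in x :: q -> path e u r -> all (free s Z) r -> touches s (last u r) ->
  link (free s Z) (approach s) (x :: take (index u (x :: q)) q ++ r).
Proof.
move=> exq xA /= /andP[fx fq] uq er fr tr.
have pre i : path e x (take i q) /\ all (free s Z) (take i q).
  by move: exq fq; rewrite -{1 2}(cat_take_drop i q) cat_path all_cat; do 2!case/andP=> -> _.
have [ei fi] := pre (index u (x :: q)).
by rewrite /link cat_path last_cat last_take_index // er ei /approach xA tr /= fx all_cat fr fi.
Qed.

(** Cut the walk at its first vertex with a neighbour in the forest. It enters
the forest only through such a vertex, since it starts outside. *)
Lemma approach_first (s : seq piece) Z x q : path e x q -> x \in A ->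
    all [predC closed_nbhd e Z] (x :: q) -> ~~ covered s x ->
    has [pred v | covered s v || touches s v] (x :: q) ->
  exists p, link (free s Z) (approach s) p.
Proof.
move=> exq xA safe xs hit.
suff [q' [eq' fq' tq']] : exists q', [/\ path e x q', all (free s Z) (x :: q')
    & touches s (last x q')].
  by exists (x :: q'); rewrite /link eq' fq' /approach xA tq'.
elim: q x exq safe xs hit {xA} => [|y q IHq] x.
  rewrite /= => _ /andP[xZ _] xs; rewrite (negPf xs) orbF /= => tx.
  by exists [::]; rewrite /= /free xZ xs.
move=> /= /andP[exy eyq] /andP[xZ safe] xs.
have [tx _|ntx] := boolP (touches s x).
  by exists [::]; rewrite /= /free xZ xs.
rewrite (negPf xs) /= => hit.
have ys : ~~ covered s y.
  by apply: contra ntx => sy; apply/touchesP; exists y.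
have [q' [eq' fq' tq']] := IHq y eyq safe ys hit.
by exists (y :: q'); split=> //; [rewrite /= exy | move: fq' => /= ->; rewrite /free xZ xs].
Qed.

(** * Packing A-paths in a comb *)

(** A boolean form of [anticomplete_paths], suited to [pairwise]. *)
Definition separate (p q : seq T) :=
  all (fun x => all (fun y => (x != y) && ~~ e x y) q) p.

Lemma separateP p q :
  reflect (forall x y, x \in p -> y \in q -> x != y /\ ~~ e x y) (separate p q).
Proof.
apply: (iffP allP) => [sep x y xp yq|sep x xp]; last first.
  by apply/allP => y yq; apply/andP; apply: sep.
exact: (andP (allP (sep x xp) y yq)).
Qed.

Lemma separateC p q : separate p q -> separate q p.
Proof.
move=> /separateP sep; apply/separateP => x y xq yp.
by have [neq nadj] := sep y x yp xq; rewrite eq_sym e_sym.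
Qed.

(** The part of a comb used by the packing: the teeth, and the spine up to the
last foot. *)
Definition below (p : seq T) (ds : seq (seq T * T)) v :=
  has (fun d : seq T * T => (v \in d.1) || (v \in p) && (index v p <= index d.2 p)) ds.

(** The last vertex of a tooth may have other neighbours on the spine than its
foot, but only near it. *)
Record tooth (p : seq T) (d : seq T * T) : Prop := Tooth {
  tooth_sorted : sorted e d.1;
  tooth_head : exists x q, d.1 = x :: q /\ x \in A;
  tooth_foot : d.2 \in p;
  tooth_last : e (last d.2 d.1) d.2;
  tooth_disjoint : forall u, u \in d.1 -> u \notin p;
  tooth_near : forall u v, u \in d.1 -> v \in p -> e u v -> gap p d.2 v <= 2 }.

Lemma tooth_connect p d (S : {set T}) : tooth p d -> {subset d.1 <= S} -> d.2 \in S ->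
  exists x, [/\ x \in d.1, x \in A & connect (inside S) x d.2].
Proof.
case: d => [c a] [/= sc [x [q [def_c xA]]] _ ca _ _] sub aS.
exists x; rewrite def_c mem_head; split=> //.
have lastc : last a c \in c by rewrite def_c /= mem_last.
apply: (connect_trans (y := last a c)).
  by apply: connect_walk sc sub _ _; rewrite // def_c mem_head.
by apply: connect1; rewrite /inside /= sub ?aS.
Qed.

Lemma slice_connect p u v (S : {set T}) : uniq p -> sorted e p -> u \in p -> v \in p ->
    index v p <= index u p ->
    (forall y, y \in p -> index v p <= index y p <= index u p -> y \in S) ->
  connect (inside S) u v.
Proof.
move=> Up sp up vp le_vu sub.
pose m := index v p; pose n := (index u p - index v p).+1.
have in_slice y : y \in take n (drop m p) = (y \in p) && (m <= index y p <= index u p).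
  by rewrite mem_slice // /m /n addnS subnKC.
apply: (@connect_walk S (take n (drop m p))).
- exact/take_sorted/drop_sorted.
- by move=> y; rewrite in_slice => /andP[]; apply: sub.
- by rewrite in_slice up le_vu leqnn.
- by rewrite in_slice vp leqnn le_vu.
Qed.

(** The teeth are listed from the far end of the spine. The first two are joined
through the spine between their feet, and the rest is packed by induction below
the foot of the second one; feet are at least 4 apart, while the neighbours of a
tooth lie within 2 of its foot, so the new path does not see the others. A single
remaining tooth is joined to the end [a] of the spine. *)
Lemma comb_packing a q (ds : seq (seq T * T)) (p := a :: q) :
    a \in A -> uniq p -> sorted e p ->
    {in p &, forall u v, e u v -> gap p u v <= 1} ->
    (forall d, d \in ds -> tooth p d) ->
    pairwise (fun d d' => separate d.1 d'.1 && (index d'.2 p + 4 <= index d.2 p)) ds ->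
  exists F : seq (seq T), [/\ size F = uphalf (size ds), all (A_path e A) F,
    pairwise separate F & forall f v, f \in F -> v \in f -> below p ds v].
Proof.
have ap : a \in p by rewrite mem_head.
have idx_a : index a p = 0 by rewrite /= eqxx.
move=> aA; clearbody p => Up sp chord; have [n] := ubnP (size ds).
elim: n ds => // n IHn [|d1 [|d2 ds]] lt_n teeth pw.
- by exists [::].
- have t1 := teeth d1 (mem_head _ _).
  pose S := [set v | below p [:: d1] v].
  have [x [xd xA xc]] : exists x, [/\ x \in d1.1, x \in A & connect (inside S) x d1.2].
    apply: (tooth_connect t1) => [v vd|]; rewrite inE /below /= ?vd //.
    by rewrite (tooth_foot t1) leqnn !orbT.
  have ac : connect (inside S) d1.2 a.
    apply: (slice_connect Up sp (tooth_foot t1) ap); first by rewrite idx_a.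
    by move=> y yp /andP[_ le_y]; rewrite inE /below /= yp le_y !orbT.
  have [|f Af fS] := connect_A_path (connect_trans xc ac) xA aA.
    by apply: contraNneq (tooth_disjoint t1 xd) => ->.
  exists [:: f]; split=> //=; first by rewrite Af.
  by move=> g v; rewrite inE => /eqP-> /fS; rewrite inE.
have t1 := teeth d1 (mem_head _ _).
have t2 := teeth d2 (mem_behead (s := [:: d1, d2 & ds]) (mem_head _ _)).
have teeth' d : d \in ds -> tooth p d by move=> dds; apply: teeth; rewrite !inE dds !orbT.
move: pw => /= /and3P[/andP[/andP[sep12 le21] pw1] pw2 pw].
have [|F [sF AF pF belowF]] := IHn ds _ teeth' pw; first by move: lt_n => /= /ltnW.
pose S := [set v | [|| v \in d1.1, v \in d2.1 |
                    (v \in p) && (index d2.2 p <= index v p <= index d1.2 p)]].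
have [x1 [x1d x1A x1c]] : exists x, [/\ x \in d1.1, x \in A & connect (inside S) x d1.2].
  apply: (tooth_connect t1) => [v vd|]; rewrite inE ?vd // (tooth_foot t1) leqnn.
  by rewrite (leq_trans _ le21) ?leq_addr ?orbT.
have [x2 [x2d x2A x2c]] : exists x, [/\ x \in d2.1, x \in A & connect (inside S) x d2.2].
  apply: (tooth_connect t2) => [v vd|]; rewrite inE ?vd ?orbT // (tooth_foot t2) leqnn.
  by rewrite (leq_trans _ le21) ?leq_addr ?orbT.
have c12 : connect (inside S) d1.2 d2.2.
  apply: (slice_connect Up sp (tooth_foot t1) (tooth_foot t2)).
    exact: leq_trans (leq_addr _ _) le21.
  by move=> y yp le_y; rewrite inE yp le_y !orbT.
have [||f Af fS] := connect_A_path (connect_trans x1c (connect_trans c12 _)) x1A x2A.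
- by rewrite inside_sym; exact: x2c.
- by have [] := separateP _ _ sep12 x1 x2 x1d x2d.
exists (f :: F); split=> /=.
- by rewrite sF.
- by rewrite Af AF.
- rewrite pF andbT; apply/allP => g gF; apply/separateP => x y /fS xS yg.
  have /hasP[d dds yd] := belowF _ _ gF yg.
  have td := teeth' d dds.
  have /andP[/separateP sep1 le1] := allP pw1 d dds.
  have /andP[/separateP sep2 le2] := allP pw2 d dds.
  move: xS; rewrite inE => /or3P[xd1|xd2|/andP[xp /andP[le_2x le_x1]]];
    case/orP: yd => [yd|/andP[yp le_yd]].
  + exact: sep1.
  + split; first by apply: contraNneq (tooth_disjoint t1 xd1) => ->.
    by apply/negP => /(tooth_near t1 xd1 yp); rewrite /gap; move: le1 le_yd; clear; lia.
  + exact: sep2.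
  + split; first by apply: contraNneq (tooth_disjoint t2 xd2) => ->.
    by apply/negP => /(tooth_near t2 xd2 yp); rewrite /gap; move: le2 le_yd; clear; lia.
  + split; first by apply: contraNneq (tooth_disjoint td yd) => <-.
    rewrite e_sym; apply/negP => /(tooth_near td yd xp).
    by rewrite /gap; move: le2 le_2x; clear; lia.
  + split; first by apply/eqP => eq_xy; move: le_2x le2 le_yd; rewrite eq_xy; clear; lia.
    by apply/negP => /(chord x y xp yp); rewrite /gap; move: le_2x le2 le_yd; clear; lia.
move=> g v; rewrite inE => /predU1P[-> /fS|gF vg]; last first.
  by rewrite /below /= (belowF g v gF vg : has _ _) !orbT.
by rewrite inE /below /= => /or3P[->|->|/andP[-> /andP[_ ->]]]; rewrite ?orbT.
Qed.

(** * The invariant of the growth *)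

(** The only kind of edge between two pieces: from the last vertex of a leg to a
vertex of its host near the anchor. *)
Definition joint (d j : piece) u v :=
  exists a, [/\ anchor d = Some a, a \in track j, u = last u (track d),
                gap (track j) a v <= 2 & color d = ~~ color j].

(** The forest [s], latest piece first, with its marked set [Z]. The field
[grown_local] is the heart of the matter; [grown_open] says what [Z] is for: the
vertices of the forest where a further leg can attach are far from all previous
anchors and not at the end where a leg is attached to its host. *)
Record grown (s : seq piece) (Z : {set T}) : Prop := Grown {
  grown_uniq : uniq s;
  grown_terminals : forall v, v \in A -> covered s v -> v \in Z;
  grown_track : forall d : piece, d \in s -> [/\ uniq (track d), sorted e (track d),
      {in track d &, forall u v, e u v -> gap (track d) u v <= 1}
    & exists x q, track d = x :: q /\ x \in A];
  grown_root : forall d : piece, d \in s -> anchor d = None -> A_path e A (track d);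
  grown_disjoint : forall (d1 d2 : piece) v, d1 \in s -> d2 \in s -> d1 != d2 ->
    v \in track d1 -> v \notin track d2;
  grown_edge : forall (d1 d2 : piece) u v, d1 \in s -> d2 \in s -> d1 != d2 ->
    u \in track d1 -> v \in track d2 -> e u v -> joint d1 d2 u v \/ joint d2 d1 v u;
  grown_anchor : forall (d : piece) a, d \in s -> anchor d = Some a -> e (last a (track d)) a
    /\ exists2 j : piece, j \in s & [/\ a \in track j, color d = ~~ color j
                            & anchor j != None -> a != last a (track j)];
  grown_acyclic : forall j d : piece, j \in s -> d \in s -> child_of j d -> ~~ child_of d j;
  grown_siblings : forall (j d d' : piece) a a', j \in s -> d \in s -> d' \in s -> d != d' ->
    anchor d = Some a -> anchor d' = Some a' -> a \in track j -> a' \in track j ->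
    4 <= gap (track j) a a';
  grown_local : forall w u v, free s Z w -> covered s u -> covered s v ->
    e w u -> e w v -> exists2 j : piece, j \in s
    & [/\ u \in track j, v \in track j & gap (track j) u v <= 2];
  grown_open : forall (j : piece) v, j \in s -> v \in track j -> v \notin Z ->
    (anchor j != None -> v != last v (track j)) /\
    forall (d : piece) a, d \in s -> anchor d = Some a -> a \in track j ->
    4 <= gap (track j) a v;
  grown_card : #|Z| <= 2 * count (fun d : piece => anchor d == None) s
                       + 10 * count (fun d : piece => anchor d != None) s }.

(** The comb of a host: its legs and itself, without its last vertex if it is a
leg, as that vertex has neighbours on another piece. *)
Definition territory (s : seq piece) (j : piece) v :=
  (v \in track j) && ((anchor j != None) ==> (v != last v (track j)))
  || has (fun d : piece => child_of j d && (v \in track d)) s.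

Lemma eq_last_index (p : seq T) u : uniq p -> u \in p ->
  (u == last u p) = (index u p == (size p).-1).
Proof.
case: p => // x q Uq uq; rewrite [last _ _]/= [_.-1]/=.
apply/eqP/eqP => [->|idx]; first exact: index_last.
by rewrite -{1}(nth_index x uq) idx (last_nth x).
Qed.

Lemma child_ofP j d : reflect (exists2 a, anchor d = Some a & a \in track j) (child_of j d).
Proof.
rewrite /child_of; case: (anchor d) => [a|]; last by constructor=> -[].
by apply: (iffP idP) => [|[_ [<-]]]; first exists a.
Qed.

(** * Packing A-paths in the forest *)

Section Packing.
Variables (s : seq piece) (Z : {set T}).
Hypothesis gsZ : grown s Z.

Lemma same_track (d1 d2 : piece) v : d1 \in s -> d2 \in s ->
  v \in track d1 -> v \in track d2 -> d1 = d2.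
Proof.
move=> d1s d2s v1 v2; have [//|neq] := eqVneq d1 d2.
by move: v2; rewrite (negPf (grown_disjoint gsZ d1s d2s neq v1)).
Qed.

Lemma child_color (j d : piece) : j \in s -> d \in s -> child_of j d -> color d = ~~ color j.
Proof.
move=> js ds /child_ofP[a da aj].
have [_ [j' j's [aj' -> _]]] := grown_anchor gsZ ds da.
by rewrite (same_track js j's aj aj').
Qed.

Lemma same_color_unrelated (j d : piece) : j \in s -> d \in s ->
  color j = color d -> ~~ child_of j d.
Proof.
by move=> js ds eq_c; apply/negP => /(child_color js ds); rewrite eq_c; case: (color d).
Qed.

Lemma child_neq (j d : piece) : j \in s -> d \in s -> child_of j d -> d != j.
Proof.
by move=> js ds jd; apply: contraTneq jd => ->; apply: same_color_unrelated.
Qed.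

Lemma joint_child (d j : piece) u v : joint d j u v -> child_of j d.
Proof. by case=> a [da aj _ _ _]; apply/child_ofP; exists a. Qed.

Lemma pieces_separate (d1 d2 : piece) : d1 \in s -> d2 \in s -> d1 != d2 ->
  ~~ child_of d1 d2 -> ~~ child_of d2 d1 -> separate (track d1) (track d2).
Proof.
move=> d1s d2s neq n12 n21; apply/separateP => x y x1 y2; split.
  by apply: contraNneq (grown_disjoint gsZ d1s d2s neq x1) => ->.
apply/negP => /(grown_edge gsZ d1s d2s neq x1 y2)[] /joint_child; exact/negP.
Qed.

Lemma child_tooth (j d : piece) a : j \in s -> d \in s ->
    anchor d = Some a -> a \in track j ->
  tooth (track j) (track d, a).
Proof.
move=> js ds da aj; have [Ud sd chd hd] := grown_track gsZ ds.
have jd : child_of j d by apply/child_ofP; exists a.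
have neq := child_neq js ds jd.
split=> //=.
- by have [] := grown_anchor gsZ ds da.
- by move=> u; apply: (grown_disjoint gsZ ds js neq).
move=> u v ud vj /(grown_edge gsZ ds js neq ud vj)[[a' [da' _ _ le_2 _]]|/joint_child dj].
  by move: da'; rewrite da => -[->].
by move: (grown_acyclic gsZ js ds jd); rewrite dj.
Qed.

(** The comb with spine [j] and the legs attached to [j] as teeth, sorted by
their anchors along the spine. *)
Lemma host_packing (j : piece) : j \in s ->
  exists F : seq (seq T), [/\ size F = uphalf (count (child_of j) s),
    all (A_path e A) F, pairwise separate F
    & forall f v, f \in F -> v \in f -> territory s j v].
Proof.
move=> js; have [Uj sj chj [x [q [def_j xA]]]] := grown_track gsZ js.
pose foot d := odflt x (anchor d).
pose r d d' := index (foot d') (track j) <= index (foot d) (track j).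
pose kids := sort r (filter (child_of j) s).
have kidP d : d \in kids -> [/\ d \in s, child_of j d, anchor d = Some (foot d)
                            & foot d \in track j].
  rewrite mem_sort mem_filter => /andP[jd ds]; split=> //; case/child_ofP: jd => a.
    by rewrite /foot => ->.
  by rewrite /foot => ->.
have r_tr : transitive r by move=> a b c; rewrite /r => h1 h2; apply: leq_trans h2 h1.
have r_total : total r by move=> a b; rewrite /r leq_total.
pose ds := [seq (track d, foot d) | d <- kids].
have comb := @comb_packing x q ds xA; rewrite -def_j in comb.
have [d||F [sF AF pF inF]] := comb Uj sj chj.
- by case/mapP=> d' /kidP[d's _ d'a d'j] ->; apply: child_tooth.
- rewrite pairwise_map /=.
  have pw_r : pairwise r kids by rewrite -sorted_pairwise // sort_sorted.
  have pw_n : pairwise (fun d d' => d != d') kids.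
    by rewrite -uniq_pairwise sort_uniq filter_uniq // (grown_uniq gsZ).
  have : pairwise (fun d d' => r d d' && (d != d')) kids by rewrite pairwise_relI pw_r.
  apply: (sub_in_pairwise (P := mem kids)) => [d d' dk d'k /andP[rd neq] /=|]; last exact/allP.
  have [ds' jd da dj] := kidP d dk; have [d's jd' d'a d'j] := kidP d' d'k.
  apply/andP; split.
    apply: pieces_separate => //; apply: same_color_unrelated => //;
      by rewrite (child_color js ds' jd) (child_color js d's jd').
  have := grown_siblings gsZ js ds' d's neq da d'a dj d'j.
  by move: rd; rewrite /r /gap; clear; lia.
exists F; split=> //; first by rewrite sF size_map size_sort size_filter.
move=> f v fF vf; have /hasP[_ /mapP[d dk ->] /= /orP[vd|/andP[vj le_v]]] := inF f v fF vf.
  apply/orP; right; apply/hasP; exists d; first by have [] := kidP d dk.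
  by rewrite vd andbT; have [] := kidP d dk.
apply/orP; left; rewrite vj; apply/implyP => janc.
have [ds' jd da dj] := kidP d dk.
have [_ [j' j's [dj' _ not_last]]] := grown_anchor gsZ ds' da.
move: not_last; rewrite -(same_track js j's dj dj') => /(_ janc).
have lt_d : index (foot d) (track j) < size (track j) by rewrite index_mem.
by rewrite !eq_last_index //; move: le_v lt_d; clear; lia.
Qed.

Lemma host_kid_apart (j j' d : piece) x y : j \in s -> j' \in s -> d \in s ->
    color j = color j' -> j != j' -> child_of j' d ->
    x \in track j -> (anchor j != None -> x != last x (track j)) -> y \in track d ->
  x != y /\ ~~ e x y.
Proof.
move=> js j's ds eq_c neq j'd xj not_last yd.
have neq_jd : j != d.
  apply/eqP => eq_jd; move: (child_color j's ds j'd).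
  by rewrite -eq_jd eq_c; case: (color j').
split; first by apply: contraNneq (grown_disjoint gsZ js ds neq_jd xj) => ->.
apply/negP => /(grown_edge gsZ js ds neq_jd xj yd)[[a [ja _ x_last _ _]]|/joint_child jd].
  by move: not_last; rewrite ja -x_last eqxx => /(_ isT).
have /child_ofP[a da aj] := jd; have /child_ofP[a' da' aj'] := j'd.
move: da'; rewrite da => -[eq_a]; rewrite -eq_a in aj'.
by rewrite (same_track js j's aj aj') eqxx in neq.
Qed.

(** Two hosts of the same colour are not attached to each other, nor are their
legs, and each leg has only one host. The remaining danger is that the host [j]
is itself a leg attached to a leg of [j'], and this edge uses only the last
vertex of [j]. *)
Lemma territory_apart (j j' : piece) x y : j \in s -> j' \in s -> color j = color j' ->
  j != j' -> territory s j x -> territory s j' y -> x != y /\ ~~ e x y.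
Proof.
move=> js j's eq_c neq /orP[/andP[xj /implyP xl]|/hasP[d ds /andP[jd xd]]]
  /orP[/andP[yj' /implyP yl]|/hasP[d' d's /andP[j'd' yd']]].
- by apply: (separateP _ _ (pieces_separate js j's neq _ _)) => //;
    apply: same_color_unrelated.
- exact: host_kid_apart j'd' xj xl yd'.
- rewrite eq_sym e_sym; apply: host_kid_apart jd yj' yl xd; rewrite // eq_sym //.
have neq_d : d != d'.
  apply: contraNneq neq => eq_d; rewrite -eq_d in j'd'.
  have /child_ofP[a da aj] := jd; have /child_ofP[a' da' aj'] := j'd'.
  by move: da'; rewrite da => -[eq_a]; apply/eqP; apply: same_track aj _; rewrite // eq_a.
apply: (separateP _ _ (pieces_separate ds d's neq_d _ _)) => //;
  by apply: same_color_unrelated => //;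
     rewrite (child_color js ds jd) (child_color j's d's j'd') eq_c.
Qed.

Lemma hosts_packing (b : bool) (js : seq piece) : uniq js -> {subset js <= s} ->
    (forall j, j \in js -> color j = b) ->
  exists F : seq (seq T), [/\ size F = \sum_(j <- js) uphalf (count (child_of j) s),
    all (A_path e A) F, pairwise separate F
    & forall f, f \in F -> exists2 j, j \in js & forall v, v \in f -> territory s j v].
Proof.
elim: js => [|j js IHjs]; first by exists [::]; rewrite big_nil.
move=> /= /andP[j_js Ujs] sub colj.
have js_s : {subset js <= s} by move=> i ijs; apply: sub; rewrite inE ijs orbT.
have js_b i : i \in js -> color i = b by move=> ijs; apply: colj; rewrite inE ijs orbT.
have [F [sF AF pF inF]] := IHjs Ujs js_s js_b.
have j_s : j \in s by rewrite sub ?mem_head.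
have [F1 [sF1 AF1 pF1 inF1]] := host_packing j_s.
exists (F1 ++ F); split.
- by rewrite size_cat sF1 sF big_cons.
- by rewrite all_cat AF1.
- rewrite pairwise_cat pF1 pF !andbT; apply/allrelP => f g fF gF.
  apply/separateP => x y xf yg; have [i ijs ing] := inF g gF.
  apply: territory_apart (inF1 f x fF xf) (ing y yg) => //; first exact: js_s.
    by rewrite (js_b i ijs) colj ?mem_head.
  by apply: contraNneq j_js => ->.
move=> f; rewrite mem_cat => /orP[fF1|fF]; last first.
  by have [i ijs inf] := inF f fF; exists i; rewrite // inE ijs orbT.
by exists j; [rewrite mem_head | move=> v; apply: inF1].
Qed.

Lemma count_le_sum (I J : eqType) (R : I -> pred J) (a : pred J) (r : seq I) (t : seq J) :
    (forall d, d \in t -> a d -> has (R^~ d) r) ->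
  count a t <= \sum_(j <- r) count (R j) t.
Proof.
elim: t => [|d t IHt] cov /=; first by [].
rewrite big_split leq_add //; last by apply: IHt => i it; apply: cov; rewrite inE it orbT.
case ad : (a d) => //; have /hasP[j jr Rjd] := cov d (mem_head _ _) ad.
by rewrite (big_rem j jr) /= Rjd leq_addr.
Qed.

(** Summing over the hosts of colour [b]: every leg of the opposite colour has
its host among them. *)
Lemma legs_packing (b : bool) : exists F : seq (seq T), [/\ all (A_path e A) F,
  pairwise separate F
  & count (fun d : piece => (anchor d != None) && (color d == ~~ b)) s <= 2 * size F].
Proof.
pose js := [seq j <- s | color j == b].
have [||j|F [sF AF pF _]] := @hosts_packing b js.
- by rewrite filter_uniq // (grown_uniq gsZ).
- by move=> j; rewrite mem_filter => /andP[].
- by rewrite mem_filter => /andP[/eqP].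
exists F; split=> //; rewrite sF big_distrr /=.
apply: (@leq_trans (\sum_(j <- js) count (child_of j) s)); last first.
  by apply: leq_sum => j _; rewrite mul2n; move: (count _ _) => n; clear; lia.
apply: count_le_sum => d ds /andP[]; case da: (anchor d) => [a|] // _ /eqP cold.
have [_ [j j_s [aj col _]]] := grown_anchor gsZ ds da.
apply/hasP; exists j; last by rewrite /child_of da.
by rewrite mem_filter j_s andbT; move: col; rewrite cold => /negb_inj ->.
Qed.

Lemma roots_packing : exists F : seq (seq T), [/\ all (A_path e A) F,
  pairwise separate F & size F = count (fun d : piece => anchor d == None) s].
Proof.
pose roots := [seq d <- s | anchor d == None].
have rootP d : d \in roots -> d \in s /\ anchor d = None.
  by rewrite mem_filter => /andP[/eqP].
exists (map track roots); split; last by rewrite size_map size_filter.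
  by apply/allP => _ /mapP[d /rootP[ds da] ->]; apply: (grown_root gsZ).
rewrite pairwise_map.
apply: (sub_in_pairwise (P := mem roots) (r := fun d d' => d != d')); last first.
- by rewrite -uniq_pairwise filter_uniq // (grown_uniq gsZ).
- exact/allP.
move=> d d' /rootP[ds da] /rootP[d's d'a] neq.
by apply: pieces_separate; rewrite // /child_of ?da ?d'a.
Qed.

End Packing.

(** * Growing the forest *)

Lemma grown_nil : grown [::] set0.
Proof. by split=> //; rewrite cards0. Qed.

Section Growth.
Variables (s : seq piece) (Z : {set T}).
Hypothesis gsZ : grown s Z.

(** The part of the argument common to roots and legs: the invariant survives if
the new piece is a shortest walk in the free region, and the remaining hypotheses
describe how it sees the old pieces. Old anchors do not lie on the new piece, and
its own anchor lies on an old one, so it starts without children. *)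
Lemma grown_cons (Q : rel T) (Z' : {set T}) (d : piece) :
    shortest (free s Z) Q (track d) ->
    (exists x q, track d = x :: q /\ x \in A) ->
    Z \subset Z' -> #|Z'| <= #|Z| + (if anchor d == None then 2 else 10) ->
    {in track d, forall v, v \in A -> v \in Z'} ->
    (anchor d = None -> A_path e A (track d)) ->
    (forall j u v, j \in s -> u \in track d -> v \in track j -> e u v -> joint d j u v) ->
    (forall w u v, free s Z w -> w \notin closed_nbhd e Z' -> u \in track d ->
       covered s v -> e w u -> e w v -> False) ->
    (forall a, anchor d = Some a -> e (last a (track d)) a
       /\ exists2 j : piece, j \in s & [/\ a \in track j, color d = ~~ color j
                            & anchor j != None -> a != last a (track j)]) ->
    (forall (j d' : piece) a a', j \in s -> d' \in s -> anchor d = Some a ->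
       anchor d' = Some a' -> a \in track j -> a' \in track j -> 4 <= gap (track j) a a') ->
    (forall v, v \in track d -> v \notin Z' -> anchor d != None -> v != last v (track d)) ->
    (forall (j : piece) v a, j \in s -> v \in track j -> v \notin Z' ->
       anchor d = Some a -> a \in track j -> 4 <= gap (track j) a v) ->
  grown (d :: s) Z'.
Proof.
move=> sd hd subZ cardZ termd rootd edged locald anchd sibd opend windowd.
have freed := allP (shortest_all sd).
have fresh u j : j \in s -> u \in track d -> u \notin track j.
  move=> js /freed/andP[_]; apply: contra => uj; apply/coveredP; by exists j.
have d_s : d \notin s.
  have [x [q [def_d _]]] := hd; have xd : x \in track d by rewrite def_d mem_head.
  by apply/negP => ds; move: (fresh x d ds xd); rewrite xd.
have anchor_s d' a : d' \in s -> anchor d' = Some a -> a \notin track d.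
  move=> d's d'a; have [_ [j js [aj _ _]]] := grown_anchor gsZ d's d'a.
  by apply: contraL aj; apply: fresh.
have anchor_d a : anchor d = Some a -> a \notin track d.
  by move=> da; have [_ [j js [aj _ _]]] := anchd a da; apply: contraL aj; apply: fresh.
split.
- by rewrite /= d_s (grown_uniq gsZ).
- move=> v vA /orP[vd|vs]; first exact: termd.
  exact: (subsetP subZ) (grown_terminals gsZ vA vs).
- move=> d'; rewrite inE => /predU1P[->|]; last exact: (grown_track gsZ).
  split=> //; [exact: shortest_uniq sd | exact: shortest_path sd |].
  by move=> u v; apply: shortest_chord sd.
- by move=> d'; rewrite inE => /predU1P[->|]; last exact: (grown_root gsZ).
- move=> d1 d2 v; rewrite !inE => /predU1P[->|d1s] /predU1P[->|d2s]; rewrite ?eqxx //.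
  + by move=> _; apply: fresh.
  + by move=> _; apply: contraL; apply: fresh.
  exact: (grown_disjoint gsZ).
- move=> d1 d2 u v; rewrite !inE => /predU1P[->|d1s] /predU1P[->|d2s]; rewrite ?eqxx //.
  + by move=> _ u1 v2 euv; left; apply: edged.
  + by move=> _ u1 v2; rewrite e_sym => evu; right; apply: edged.
  exact: (grown_edge gsZ).
- move=> d' a; rewrite inE => /predU1P[->|d's] d'a.
    have [eda [j js jP]] := anchd a d'a.
    by split=> //; exists j; rewrite // inE js orbT.
  have [eda [j js jP]] := grown_anchor gsZ d's d'a.
  by split=> //; exists j; rewrite // inE js orbT.
- move=> j d'; rewrite !inE => /predU1P[->|js] /predU1P[->|d's].
  + by case/child_ofP => a /anchor_d/negPf->.
  + by case/child_ofP => a /(anchor_s _ _ d's)/negPf->.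
  + by move=> _; apply/child_ofP => -[a /(anchor_s _ _ js)/negPf->].
  exact: (grown_acyclic gsZ).
- move=> j d1 d2 a1 a2; rewrite !inE => /predU1P[->|js].
    move=> /predU1P[->|d1s] _ _ d1a _.
      by move=> ad; rewrite (negPf (anchor_d _ d1a)) in ad.
    by move=> ad; rewrite (negPf (anchor_s _ _ d1s d1a)) in ad.
  move=> /predU1P[->|d1s] /predU1P[->|d2s]; rewrite ?eqxx // => neq d1a d2a aj1 aj2.
  + exact: sibd d1a d2a aj1 aj2.
  + by rewrite gapC; apply: sibd d2a d1a aj2 aj1.
  exact: (grown_siblings gsZ) neq d1a d2a aj1 aj2.
- move=> w u v wfree; have [wsZ wZ' wd] := free_sub subZ wfree.
  move=> /orP[ud|us] /orP[vd|vs] ewu ewv.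
  + exists d; first exact: mem_head.
    by split=> //; apply: shortest_detour sd ud vd wsZ ewu ewv.
  + by case: (locald w u v).
  + by case: (locald w v u).
  have [j js jP] := grown_local gsZ wsZ us vs ewu ewv.
  by exists j; rewrite // inE js orbT.
- move=> j v; rewrite inE => /predU1P[->|js] vj vZ'.
    split; first exact: opend.
    move=> d' a; rewrite inE => /predU1P[->|d's] d'a ad.
      by rewrite (negPf (anchor_d _ d'a)) in ad.
    by rewrite (negPf (anchor_s _ _ d's d'a)) in ad.
  have vZ : v \notin Z by apply: contra vZ'; apply: (subsetP subZ).
  have [j_last j_open] := grown_open gsZ js vj vZ.
  split=> // d' a; rewrite inE => /predU1P[->|d's] d'a aj; first exact: windowd d'a aj.
  exact: j_open d'a aj.
move: cardZ (grown_card gsZ) => /=; case: (anchor d == None) => /=;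
  move: (count _ s) (count _ s) => m n; clear; lia.
Qed.

Lemma far_from_window (p : seq T) a v : uniq p -> v \in p ->
  v \notin take 7 (drop (index a p - 3) p) -> 4 <= gap p a v.
Proof. by move=> Up vp; rewrite mem_slice // vp /gap; clear; lia. Qed.

(** Since no leg exists, neither the new root nor a free neighbour of it can have
a neighbour in the forest: a part of the root would lead there. *)
Lemma grow_root p : (forall p', ~ link (free s Z) (approach s) p') ->
    shortest (free s Z) crossing p ->
  exists d Z', grown (d :: s) Z'.
Proof.
case: p => [|x q] no_leg sp; first by case: sp.
have /and3P[exq /and3P[xA lA neq] _] := proj1 sp.
exists (x :: q, false, None), (Z :|: [set x; last x q]).
have stop u r : u \in x :: q -> path e u r -> all (free s Z) r ->
    touches s (last u r) -> False.
  move=> uq er fr tr; apply: no_leg (approach_stop exq xA _ uq er fr tr).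
  exact: shortest_all sp.
have no_touch u : u \in x :: q -> ~~ touches s u.
  by move=> uq; apply/negP => /(stop u [::] uq isT isT).
apply: (grown_cons (Q := crossing)) => //=.
- by exists x, q.
- exact: subsetUl.
- by rewrite (leq_trans (leq_card_setU _ _)) // leq_add2l cards2; case: (x != _).
- move=> v vq vA; rewrite !inE; case: (eqVneq v x) => [|neq_v]; first by rewrite orbT.
  apply/orP; right; rewrite /=.
  (* A vertex of A inside the root would end a shorter A-path. *)
  have lv : link (free s Z) crossing (x :: take (index v (x :: q)) q).
    have := exq; have := shortest_all sp.
    rewrite /link last_take_index // /crossing xA vA eq_sym neq_v /= => /andP[-> fq].
    have pre i : path e x q -> path e x (take i q) && all (free s Z) (take i q).
      by move: fq; rewrite -{1 2}(cat_take_drop i q) cat_path all_cat => /andP[-> _] /andP[-> _].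
    by move=> /pre ->.
  have := proj2 sp _ lv; rewrite /= ltnS size_take.
  have le_v : index v (x :: q) <= size q by move: vq; rewrite -index_mem.
  move=> le_q; have := eq_last_index (shortest_uniq sp) vq.
  by rewrite [last _ _]/= => ->; apply/eqP; move: le_q le_v => /=; case: ltnP; lia.
- move=> _; have Uq := shortest_uniq sp.
  rewrite /A_path /graph_path Uq xA lA [sorted _ _]exq /= andbT ltnS lt0n size_eq0.
  by apply: contraNneq neq => ->.
- move=> j u v js uq vj euv; case/negP: (no_touch u uq); apply/touchesP.
  by exists v => //; apply/coveredP; exists j.
move=> w u v wf wZ' uq vs ewu ewv; apply: (stop u [:: w]) => //=.
- by rewrite e_sym ewu.
- by rewrite wf.
by apply/touchesP; exists v.
Qed.

(** A vertex of the new leg other than its last one with a neighbour in the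
forest would end a shorter leg. A free vertex [w'] with neighbours both on the leg
and in the forest would also end a leg, shorter unless [w'] is next to one of the
last two vertices of the leg; these are marked. *)
Lemma grow_leg p : shortest (free s Z) (approach s) p -> exists d Z', grown (d :: s) Z'.
Proof.
case: p => [|x q] sp; first by case: sp.
have fp := allP (shortest_all sp); have /and3P[exq xw _] := proj1 sp.
set w := last x q in xw; have wq : w \in x :: q by rewrite mem_last.
have /andP[xA /touchesP[a /coveredP[j js aj] ewa]] := xw.
have /andP[wZ _] := fp _ wq.
have aZ : a \notin Z := closed_nbhd_adj wZ ewa.
have le_idx u : u \in x :: q -> index u (x :: q) <= size q.
  by move=> uq; move: uq; rewrite -index_mem.
have stop u r : u \in x :: q -> path e u r -> all (free s Z) r ->
    touches s (last u r) -> size q <= index u (x :: q) + size r.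
  move=> uq er fr tr.
  have := proj2 sp _ (approach_stop exq xA (shortest_all sp) uq er fr tr).
  by rewrite /= ltnS size_cat size_takel // le_idx.
(* The penultimate vertex; it is [x] when the leg has a single vertex. *)
pose y := nth x (x :: q) (size q).-1.
pose window := take 7 (drop (index a (track j) - 3) (track j)).
pose Z' := Z :|: [set:: [:: x, w, y & window]].
exists (x :: q, ~~ color j, Some a), Z'.
have Z'E v : v \notin Z' -> [/\ v != x, v != w, v != y & v \notin window].
  by rewrite !inE => /norP[_ /norP[-> /norP[-> /norP[-> ->]]]].
apply: (grown_cons (Q := approach s)) => //=.
- by exists x, q.
- exact: subsetUl.
- rewrite (leq_trans (leq_card_setU _ _)) // leq_add2l cardsE.
  by rewrite (leq_trans (card_size _)) //= !ltnS size_take; case: ltnP.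
- move=> v vq vA; suff -> : v = x by rewrite !inE eqxx orbT.
  (* A later vertex of A would start a shorter leg. *)
  have lv : link (free s Z) (approach s) (v :: drop (index v (x :: q)) q).
    have := exq; have := shortest_all sp; have := last_take_index vq.
    have := fp v vq; have /andP[_ tw] := xw; move: (index v _) => i fv lv /= /andP[_ fq] eq0.
    move: tw fq eq0; rewrite /w -{1 2 3}(cat_take_drop i q) last_cat all_cat cat_path lv.
    by move=> tw /andP[_ fq] /andP[_ eq0]; rewrite /link eq0 /approach vA tw /= fv fq.
  have := proj2 sp _ lv; rewrite /= ltnS size_drop => le_q.
  have idx0 : index v (x :: q) = 0 \/ q = [::].
    move: le_q (le_idx v vq); case: (q) => [|z q'] /=; first by right.
    by left; move: le_q; case: eqP => //; clear; lia.
  case: idx0 => [idx0|q0]; last by move: vq; rewrite q0 inE => /eqP.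
  by rewrite -(nth_index x vq) idx0.
- move=> j' u v j's uq vj' euv.
  have tu : touches s u by apply/touchesP; exists v => //; apply/coveredP; exists j'.
  have := stop u [::] uq isT isT tu; rewrite addn0 => le_q.
  have u_w : u = w.
    rewrite /w -(nth_index x uq) (last_nth x); congr nth.
    by apply/eqP; rewrite eqn_leq le_q le_idx.
  have av : covered s a by apply/coveredP; exists j.
  have vv : covered s v by apply/coveredP; exists j'.
  have ewv : e w v by rewrite -u_w.
  have [j0 j0s [a0 v0 le_2]] := grown_local gsZ (fp w wq) av vv ewa ewv.
  have eq_j := same_track gsZ js j0s aj a0.
  have eq_j' := same_track gsZ j's j0s vj' v0.
  by exists a; rewrite eq_j' eq_j.
- move=> w' u v w'f w'Z' uq vs ewu ewv.
  have /(closed_nbhd_adj w'Z')/Z'E[_ uw uy _] := ewu.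
  have : size q <= index u (x :: q) + size [:: w'].
    apply: stop => //=; first by rewrite e_sym ewu.
      by rewrite w'f.
    by apply/touchesP; exists v.
  have : index u (x :: q) != size q.
    apply: contraNneq uw => idx; rewrite /w -(nth_index x uq) (last_nth x).
    by rewrite idx.
  have : index u (x :: q) != (size q).-1.
    by apply: contraNneq uy => idx; rewrite /y -idx nth_index.
  by have := le_idx u uq; rewrite [size [:: _]]/=; move: (index u _) => i; clear; lia.
- move=> _ [<-]; split; first exact: ewa.
  exists j => //; split=> //; exact: (proj1 (grown_open gsZ js aj aZ)).
- move=> j1 d' a1 a' j1s d's [<-] d'a' aj1 a'j1.
  by rewrite gapC; apply: (proj2 (grown_open gsZ j1s aj1 aZ)) d'a' a'j1.
- by move=> v _ /Z'E[_ vw _ _] _.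
move=> j1 v _ j1s vj1 /Z'E[_ _ _ v_out] [<-] aj1.
have eq_j := same_track gsZ js j1s aj aj1; rewrite -eq_j in vj1 *.
by apply: far_from_window => //; have [] := grown_track gsZ js.
Qed.

End Growth.

(** If there is no leg, an A-path avoiding N[Z] cannot come near the forest, as
it starts outside it; so there is a candidate for a root. *)
Lemma grow (s : seq piece) Z p : grown s Z -> A_path_minus e (closed_nbhd e Z) A p ->
  exists d Z', grown (d :: s) Z'.
Proof.
move=> gsZ; have [[p' leg]|no_leg] := classic (exists p', link (free s Z) (approach s) p').
  by move=> _; have [p1 /(grow_leg gsZ)] := ex_shortest leg.
have {}no_leg p' : ~ link (free s Z) (approach s) p' by move=> leg; apply: no_leg; exists p'.
case: p => [|x q] //= /andP[/and4P[/andP[exq Uq] q_gt0 xA lA] safe].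
have {}exq : path e x q := exq.
have xs : ~~ covered s x.
  apply/negP => xs; have /andP[/negP[]] := safe; apply: closed_nbhd_self.
  exact: (grown_terminals gsZ xA xs).
have all_free : all (free s Z) (x :: q).
  apply/allP => v vq; apply/andP; split; first exact: (allP safe v vq).
  apply/negP => vs.
  have [|p'] := approach_first exq xA safe xs; last exact: no_leg.
  by apply/hasP; exists v; rewrite //= vs.
have cross : link (free s Z) crossing (x :: q).
  rewrite /link exq all_free /crossing xA lA !andbT /=.
  (* The ends of an A-path differ, as it is repetition-free with an edge. *)
  case/lastP: q q_gt0 Uq {exq lA safe all_free} => // q z _.
  by rewrite last_rcons /= mem_rcons inE negb_or => /andP[/andP[]].
by have [p' /(grow_root gsZ no_leg)] := ex_shortest cross.
Qed.

(** * The bound on the marked set *)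

Lemma family_of_seq k (F : seq (seq T)) : all (A_path e A) F -> pairwise separate F ->
    k <= size F ->
  exists P : 'I_k -> seq T, (forall i, A_path e A (P i)) /\
    (forall i j, i != j -> anticomplete_paths e (P i) (P j)).
Proof.
move=> AF pF le_k; exists (fun i => nth [::] F i).
have lt_F (i : 'I_k) : i < size F := leq_trans (ltn_ord i) le_k.
split=> [i|i j neq]; first exact: (allP AF) (mem_nth _ (lt_F i)).
have /separateP sep : separate (nth [::] F i) (nth [::] F j).
  have pw := pairwiseP [::] pF.
  have [lt_ij|lt_ji|eq_ij] := ltngtP i j; first exact: pw (lt_F i) (lt_F j) lt_ij.
    exact/separateC/(pw _ _ (lt_F j) (lt_F i) lt_ji).
  by case/eqP: neq; apply: val_inj.
split=> [|x y]; last by rewrite !inE => xi yj; have [] := sep x y xi yj.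
apply/setP => v; rewrite !inE; apply/negP => /andP[vi vj].
by have [] := sep v v vi vj; rewrite eqxx.
Qed.

End CoarseGallai.

Theorem theorem3 (k : nat) (hk : 0 < k) (T : finType) (e : rel T)
    (e_sym : symmetric e) (e_irr : irreflexive e) (A : {set T}) :
  (exists P : 'I_k -> seq T,
      (forall i, A_path e A (P i)) /\
      (forall i j, i != j -> anticomplete_paths e (P i) (P j))) \/
  (exists Z : {set T},
      #|Z| <= 54 * (k - 1) /\
      forall p : seq T, ~~ A_path_minus e (closed_nbhd e Z) A p).
Proof.
have [//|no_family] := classic (exists P : 'I_k -> seq T,
      (forall i, A_path e A (P i)) /\
      (forall i j, i != j -> anticomplete_paths e (P i) (P j))); first by left.
right.
have small F : all (A_path e A) F -> pairwise (separate e) F -> size F <= k - 1.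
  move=> AF pF; rewrite leqNgt; apply/negP => lt_F; apply: no_family.
  by apply: family_of_seq AF pF _ => //; move: hk lt_F; clear; lia.
have bounds s Z : grown e A s Z ->
    count (fun d => anchor d == None) s <= k - 1 /\
    count (fun d => anchor d != None) s <= 4 * (k - 1).
  move=> gsZ; have [F [AF pF <-]] := roots_packing gsZ; split; first exact: small.
  have [F0 [AF0 pF0 le0]] := legs_packing e_sym gsZ false.
  have [F1 [AF1 pF1 le1]] := legs_packing e_sym gsZ true.
  (* Legs of either colour are packed by means of hosts of the other one. *)
  have split_legs : count (fun d => anchor d != None) s
     = count (fun d => (anchor d != None) && (color d == ~~ false)) s
       + count (fun d => (anchor d != None) && (color d == ~~ true)) s.
    elim: s {gsZ F AF pF F0 AF0 pF0 le0 F1 AF1 pF1 le1} => //= d s ->.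
    by rewrite addnACA; case: (anchor d == None) (color d) => -[].
  rewrite split_legs (leq_trans (leq_add le0 le1)) //.
  by move: (small _ AF0 pF0) (small _ AF1 pF1); clear; lia.
have [s [Z [gsZ stop]]] : exists s Z, grown e A s Z /\
    forall p, ~~ A_path_minus e (closed_nbhd e Z) A p.
  (* Otherwise the growth never stops and gets past 5(k-1) pieces. *)
  have [//|never] := classic (exists s Z, grown e A s Z /\
    forall p, ~~ A_path_minus e (closed_nbhd e Z) A p).
  suff [s [Z [gsZ size_s]]] : exists s Z, grown e A s Z /\ size s = (5 * (k - 1)).+1.
    have [le_r le_l] := bounds s Z gsZ.
    have split_s : count (fun d => anchor d == None) s
      + count (fun d => anchor d != None) s = size s := count_predC _ s.
    by move: (leq_add le_r le_l); rewrite split_s size_s; clear; lia.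
  elim: (_.+1) => [|n [s [Z [gsZ size_s]]]]; first by exists [::], set0; split; first exact: grown_nil.
  have [[p ap]|no_path] := classic (exists p, A_path_minus e (closed_nbhd e Z) A p).
    have [d [Z' gdsZ']] := grow e_sym gsZ ap.
    by exists (d :: s), Z'; rewrite /= size_s.
  case: never; exists s, Z; split=> // p; apply/negP => ap; apply: no_path.
  by exists p.
exists Z; split=> //; have [le_r le_l] := bounds s Z gsZ.
apply: leq_trans (grown_card gsZ) _; move: le_r le_l; clear; lia.
Qed.
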